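(* Let $d\ge2$ be an integer and $0<\varepsilon\le\frac1{\sqrt2}$. Any $(d,\varepsilon)$-port based teleportation protocol uses at least $$ N\ \ge\ \frac{d}{2\sqrt{2\varepsilon}} $$ output ports.
   Context: All Hilbert spaces are finite-dimensional. An $N$-port port based teleportation (PBT) protocol for a $d$-dimensional system is given by a resource state $\rho_{A'B_1\cdots B_N}$ (with $\mathcal H_{A'}$ arbitrary, each $\mathcal H_{B_i}\cong\mathcal H_B\cong\mathbb C^d$) shared between Alice ($A'$) and Bob ($B^N=B_1\cdots B_N$), and an $N$-outcome POVM $\{(E_i)_{A_0A'}\}_{i=1}^N$ on $\mathcal H_{A_0}\otimes\mathcal H_{A'}$, where $\mathcal H_{A_0}\cong\mathbb C^d$ is the input register. Alice measures, sends the outcome $i$, and Bob keeps port $B_i$. The resulting channel is $$\Lambda_{A_0\to B}(X)=\sum_{i=1}^N\mathrm{tr}_{A_0A'B_{i^c}}\big[(E_i)_{A_0A'}(X_{A_0}\otimes\rho_{A'B^N})\big],$$ where $B_{i^c}$ denotes all ports except $B_i$ and $B_i$ is renamed $B$ in each summand. It is a $(d,\varepsilon)$-PBT protocol if $\|\Lambda_{A_0\to B}-\mathrm{id}_{A_0\to B}\|_\diamond\le\varepsilon$, where $\|\Lambda\|_\diamond=\sup_{\rho_{AE}}\|(\Lambda\otimes\mathrm{id}_E)(\rho_{AE})\|_1$ over all auxiliary systems $E$ and states $\rho_{AE}$. *)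

(* Defs.v *)
From HB Require Import structures.
From mathcomp Require Import all_boot all_order all_algebra.
From mathcomp Require Import complex mxtens.
From mathcomp Require Import classical_sets reals constructive_ereal ereal.

Set Implicit Arguments.
Unset Strict Implicit.
Unset Printing Implicit Defensive.

Import Order.TTheory GRing.Theory Num.Theory.

Local Open Scope ring_scope.
Local Open Scope sesquilinear_scope.
Local Open Scope complex_scope.

Section Operators.
Variable R : realType.
Local Notation C := R[i].

(* The order of [R[i]] makes [0 <= z] imply that [z] is real, so [psdmx A]
   forces [A] to be Hermitian. *)
Definition psdmx n (A : 'M[C]_n) : Prop :=
  forall v : 'cV[C]_n, 0 <= (v ^t* *m A *m v) 0 0.

Definition density n (rho : 'M[C]_n) : Prop := psdmx rho /\ \tr rho = 1.

(* Only used at positive semidefinite matrices, where it is the positive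
   semidefinite square root. *)
Definition sqrtmx n (A : 'M[C]_n) : 'M[C]_n :=
  invmx (spectralmx A) *m diag_mx (map_mx sqrtC (spectral_diag A))
    *m spectralmx A.

Definition trace_norm n (X : 'M[C]_n) : R :=
  complex.Re (\tr (sqrtmx (X ^t* *m X))).

(* [C^m (x) C^n] is [C^(m * n)] with the indexing [mxtens_index] of [tensmx]. *)
Definition ptrace_l m n (M : 'M[C]_(m * n)) : 'M[C]_n :=
  \matrix_(k, l) \sum_(i < m) M (mxtens_index (i, k)) (mxtens_index (i, l)).

Definition ampliation m n e (f : {linear 'M[C]_m -> 'M[C]_n})
    (M : 'M[C]_(m * e)) : 'M[C]_(n * e) :=
  \sum_(k < e) \sum_(l < e)
    f (\matrix_(x, y) M (mxtens_index (x, k)) (mxtens_index (y, l)))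
      *t delta_mx k l.

(* The supremum is taken in the extended reals, so that no convention about
   unbounded sets is involved. *)
Definition diamond_norm m n (f : {linear 'M[C]_m -> 'M[C]_n}) : \bar R :=
  ereal_sup [set x : \bar R | exists (e : nat) (rho : 'M[C]_(m * e)),
    density rho /\ x = (trace_norm (ampliation f rho))%:E]%classic.

End Operators.

(* The computational basis of [B_1 ... B_N] is the set of words [f] with
   [f j] in ['I_d], ordered by [enum_rank]. *)
Definition ports_dim d N := #|{ffun 'I_N -> 'I_d}|.

Section PBT.
Variable R : realType.
Local Notation C := R[i].

(* Partial trace over all ports except [i]. *)
Definition ptrace_ports d N (i : 'I_N) (M : 'M[C]_(ports_dim d N)) : 'M[C]_d :=
  \matrix_(k, l) \sum_(f : {ffun 'I_N -> 'I_d} | f i == k)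
    M (enum_rank f) (enum_rank [ffun j => if j == i then l else f j]).

Record pbt_protocol d N := PBTProtocol {
  alice_dim : nat;
  resource : 'M[C]_(alice_dim * ports_dim d N);
  povm : 'I_N -> 'M[C]_(d * alice_dim);
  resource_density : density resource;
  povm_psd : forall i, psdmx (povm i);
  povm_sum : \sum_i povm i = 1%:M
}.

Variables (d N : nat) (P : pbt_protocol d N).
Local Notation a := (alice_dim P).
Local Notation b := (ports_dim d N).

(* The cast is the associativity of the tensor product of [A_0], [A'], [B^N]. *)
Definition pbt_channel (X : 'M[C]_d) : 'M[C]_d :=
  \sum_(i < N) ptrace_ports i (ptrace_l
    ((povm P i *t (1%:M : 'M[C]_b)) *m
     castmx (mulnA d a b, mulnA d a b) (X *t resource P))).

Lemma pbt_channel_is_linear : linear pbt_channel.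
Proof.
move=> c X Y; rewrite /pbt_channel scaler_sumr -big_split /=.
apply: eq_bigr => i _.
have -> : castmx (mulnA d a b, mulnA d a b) ((c *: X + Y) *t resource P) =
    c *: castmx (mulnA d a b, mulnA d a b) (X *t resource P) +
    castmx (mulnA d a b, mulnA d a b) (Y *t resource P).
  by apply/matrixP => x y; rewrite !(mxE, castmxE) /= mulrDl mulrA.
rewrite mulmxDr -scalemxAr; apply/matrixP => k l.
rewrite !mxE mulr_sumr -big_split /=; apply: eq_bigr => f _.
rewrite !mxE mulr_sumr -big_split /=; apply: eq_bigr => j _.
by rewrite !mxE.
Qed.

HB.instance Definition _ :=
  GRing.isLinear.Build C 'M[C]_d 'M[C]_d *:%R pbt_channel pbt_channel_is_linear.

Definition is_pbt (eps : R) : Prop :=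
  (diamond_norm (pbt_channel \- idfun)%R <= eps%:E)%E.

End PBT.

(* Main.v *)
(* Teleport half of a maximally entangled state.  For outcome i let S_i be the
   unnormalised state of the reference system and the ports, and let phi_j be
   the projection onto the maximally entangled state of the reference system and
   port j.  Since Alice's measurement cannot be seen by Bob, sum_i S_i is the
   product of the maximally mixed state and a state of the ports, so every phi_j
   has expectation 1/d^2 in it, while sum_i tr (S_i phi_i) is the entanglement
   fidelity F.  For i <> j one has phi_i phi_j phi_i = d^-2 phi_i, which forces
   phi_i <= 1 - c / (d^2 (1 + c)) + c phi_j for all c > 0.  Summing the
   expectations over i <> j bounds F, and c of order d sqrt eps gives the claim,
   because 2 (1 - F) <= eps by testing the diamond norm on the maximally
   entangled state. *)

Require Import Defs.
From mathcomp Require Import all_boot all_order all_algebra.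
From mathcomp Require Import complex mxtens.
From mathcomp Require Import classical_sets reals constructive_ereal ereal.
From mathcomp Require Import ring lra.

Set Implicit Arguments.
Unset Strict Implicit.
Unset Printing Implicit Defensive.

Import Order.TTheory GRing.Theory Num.Theory.
Local Open Scope ring_scope.
Local Open Scope sesquilinear_scope.

(** * Positive semidefinite matrices and the trace norm *)

Section PsdMatrices.
Variable R : realType.
Local Notation C := R[i].

Lemma trmxC_mul m n p (A : 'M[C]_(m, n)) (B : 'M[C]_(n, p)) :
  (A *m B) ^t* = B ^t* *m A ^t*.
Proof. by rewrite trmx_mul map_mxM. Qed.

Lemma gram_diag m n (A : 'M[C]_(m, n)) (S : 'M[C]_n) i :
  (A *m S *m A ^t*) i i = ((row i A) ^t* ^t* *m S *m (row i A) ^t*) 0 0.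
Proof.
rewrite trmxCK -!mulmxA -row_mul !mxE; apply: eq_bigr => j _.
by rewrite !mxE; congr (_ * _); apply: eq_bigr => k _; rewrite !mxE.
Qed.

Lemma psd_conj_diag m n (A : 'M[C]_(m, n)) (S : 'M[C]_n) i :
  psdmx S -> 0 <= (A *m S *m A ^t*) i i.
Proof. by move=> hS; rewrite gram_diag; apply: hS. Qed.

Lemma psd_tr_ge0 m n (S : 'M[C]_n) (A : 'M[C]_(m, n)) :
  psdmx S -> 0 <= \tr (S *m (A ^t* *m A)).
Proof.
by move=> hS; rewrite mulmxA mxtrace_mulC mulmxA; apply: sumr_ge0 => i _;
  apply: psd_conj_diag.
Qed.

Lemma psd_gram m n (A : 'M[C]_(m, n)) : psdmx (A ^t* *m A).
Proof.
move=> v; rewrite mulmxA -trmxC_mul -mulmxA mxE.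
by apply: sumr_ge0 => i _; rewrite !mxE mulrC mul_conjC_ge0.
Qed.

(** Polarisation: since the form of [A] is real, the form of [B = A ^t* - A] vanishes at every
    vector. Testing it at [e_i + c e_j] kills the diagonal with [c = 0], and then [c = 1] and
    [c = 'i] give [B i j = - B j i] and [B i j = B j i]. *)
Lemma psd_hermitian n (A : 'M[C]_n) : psdmx A -> A ^t* = A.
Proof.
move=> hA; have q0 (v : 'cV[C]_n) : (v ^t* *m (A ^t* - A) *m v) 0 0 = 0.
  have /ger0_real/CrealP := hA v.
  have e (M1 M2 : 'M[C]_1) : (M1 - M2) 0 0 = M1 0 0 - M2 0 0 by rewrite !mxE.
  rewrite mulmxBr mulmxBl e => <-.
  rewrite -{2}[v]trmxCK -!trmxC_mul mulmxA.
  by rewrite !mxE subrr.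
apply/eqP; rewrite -subr_eq0; apply/eqP; move: (A ^t* - A) q0 => B q0.
have qB (c : C) i j : B i i + c * B i j + Num.conj c * (B j i + c * B j j) = 0.
  rewrite -(q0 (delta_mx i 0 + c *: delta_mx j 0)).
  have -> : (delta_mx i 0 + c *: delta_mx j 0 : 'cV[C]_n) ^t* =
      delta_mx 0 i + Num.conj c *: delta_mx 0 j.
    apply/matrixP => k l; rewrite !mxE rmorphD rmorphM /= !conjC_nat.
    by rewrite ![_ && (k == _)]andbC.
  rewrite !(mulmxDl, mulmxDr) -?scalemxAl -?scalemxAr -?scalemxAl.
  have e k l : (delta_mx 0 k *m B *m delta_mx l 0 : 'M_1) 0 0 = B k l.
    by rewrite -rowE -colE !mxE.
  by rewrite !mxE -!e !mxE; ring.
have dB i : B i i = 0 by move: (qB 0 i i); rewrite !mul0r conjC0 mul0r !addr0.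
apply/matrixP => i j; rewrite [RHS]mxE.
have := qB 1 i j; have := qB 'i i j.
rewrite !dB conjCi conjC1 !mul1r !mulr0 !add0r !addr0 mulNr.
move=> /eqP; rewrite subr_eq0 => /eqP/(mulfI (neq0Ci _)) ->.
by rewrite -mulr2n => /eqP; rewrite mulrn_eq0 => /eqP.
Qed.

Lemma hermitian_normal n (A : 'M[C]_n) : A ^t* = A -> A \is normalmx.
Proof. by move=> hA; apply/normalmxP; rewrite hA. Qed.

Lemma spectral_decomp n (A : 'M[C]_n) : A ^t* = A ->
  spectralmx A *m A *m (spectralmx A) ^t* = diag_mx (spectral_diag A).
Proof.
move=> hA; have /orthomx_spectralP {2}-> := hermitian_normal hA.
have uV := spectral_unitarymx A.
rewrite invmx_unitary // !mulmxA mulmxtVK //.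
by have /unitarymxP -> := uV; rewrite mul1mx.
Qed.

Lemma psd_factor n (A : 'M[C]_n) : psdmx A -> exists B : 'M[C]_n, A = B ^t* *m B.
Proof.
move=> hA; have hH := psd_hermitian hA; have sd := spectral_decomp hH.
exists (diag_mx (map_mx sqrtC (spectral_diag A)) *m spectralmx A).
have /orthomx_spectralP {1}-> := hermitian_normal hH.
rewrite invmx_unitary ?spectral_unitarymx // trmxC_mul -!mulmxA.
congr (_ *m _); rewrite mulmxA; congr (_ *m _).
rewrite tr_diag_mx map_diag_mx mulmx_diag; congr diag_mx; apply/rowP => j.
have d0 : 0 <= spectral_diag A 0 j.
  by have := psd_conj_diag (spectralmx A) j hA; rewrite sd mxE eqxx mulr1n.
by rewrite !mxE /= geC0_conj ?sqrtC_ge0 // -expr2 sqrtCK.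
Qed.

(** Half of the variational formula for the trace norm. In an eigenbasis [V] of [X ^t* *m X] the
    trace is a sum of inner products of rows of [V *m K] and of [V *m X ^t*]. The former are unit
    vectors, the latter have the singular values of [X] as norms, and Cauchy-Schwarz applies to each
    term. *)
Lemma Re_tr_le_trace_norm n (X K : 'M[C]_n) :
  K \is unitarymx -> complex.Re (\tr (K *m X)) <= trace_norm X.
Proof.
move=> uK; rewrite /trace_norm /sqrtmx; set A := X ^t* *m X.
have hA : A ^t* = A by rewrite trmxC_mul trmxCK.
have uV := spectral_unitarymx A; have sd := spectral_decomp hA.
set V := spectralmx A in uV sd *.
have -> : \tr (K *m X) = \sum_j (V *m K *m X *m V ^t*) j j.
  rewrite -[RHS]/(\tr _) [RHS]mxtrace_mulC !mulmxA -invmx_unitary //.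
  by rewrite mulVmx ?unitarymx_unit // mul1mx.
rewrite mxtrace_mulC mulmxA mulmxV ?unitarymx_unit // mul1mx mxtrace_diag.
rewrite !raddf_sum /=; apply: ler_sum => j _.
set z := _ j j; apply: (le_trans (ler_norm _)).
rewrite -lecR; apply: (le_trans (normc_ge_Re _)).
have -> : z = dotmx (row j (V *m K)) (row j (V *m X ^t*)).
  rewrite dotmxE /z -[_ *m V^t*]mulmxA mxE [RHS]mxE; apply: eq_bigr => k _.
  rewrite !mxE rmorph_sum /=; congr (_ * _); apply: eq_bigr => l _.
  by rewrite !mxE rmorphM /= conjCK mulrC.
have CS (u v : 'rV[C]_n) : `|dotmx u v| <= sqrtC (dotmx u u) * sqrtC (dotmx v v).
  exact: (CauchySchwarz_sqrt (@dotmx C n) u v).1.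
have d1 (B : 'M[C]_n) : dotmx (row j B) (row j B) = (B *m B ^t*) j j.
  by rewrite dotmxE !mxE; apply: eq_bigr => k _; rewrite !mxE.
apply: (le_trans (CS _ _)); rewrite !d1 !trmxC_mul trmxCK !mulmxA mulmxtVK //.
rewrite (unitarymxP uV) mxE eqxx sqrtC1 mul1r -[V *m _ *m X]mulmxA sd.
rewrite !mxE eqxx mulr1n RRe_real // ger0_real // sqrtC_ge0.
have := psd_conj_diag V j (psd_gram X).
by rewrite sd !mxE eqxx mulr1n.
Qed.

End PsdMatrices.

(** * An operator inequality for two projections *)

Section TwoProjections.
Variable R : realType.
Local Notation C := R[i].

(* With A = x (1 - q) + y q, which is invertible, A - p is
   (A - p) A^-1 (A - p) plus a multiple of p. *)
Lemma two_projections_ge0 n (S p q : 'M[C]_n) (k x y : C) :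
    psdmx S -> p ^t* = p -> q ^t* = q -> p *m p = p -> q *m q = q ->
    p *m q *m p = k *: p -> 0 < x -> 0 < y -> (1 - k) / x + k / y <= 1 ->
  0 <= x * \tr S + (y - x) * \tr (S *m q) - \tr (S *m p).
Proof.
move=> hS hp hq pp qq pqp x0 y0 hxy.
suff : 0 <= \tr (S *m (x *: (1%:M - q) + y *: q - p)).
  congr (0 <= _); rewrite scalerBr mulmxBr 2!mulmxDr mulmxN -!scalemxAr mulmx1.
  by rewrite !(mxtraceD, raddfN) /= !mxtraceZ; ring.
have [xN0 yN0] : x != 0 /\ y != 0 by rewrite !gt_eqF.
have xC : Num.conj x = x by apply/CrealP/gtr0_real.
have yC : Num.conj y = y by apply/CrealP/gtr0_real.
have herm1 (z : C) : Num.conj z = z -> (z%:M - p) ^t* = z%:M - p.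
  by move=> zC; rewrite linearB /= map_mxB tr_scalar_mx map_scalar_mx /= zC hp.
have herm2 : (1%:M - q) ^t* = 1%:M - q.
  by rewrite linearB /= map_mxB tr_scalar_mx map_scalar_mx /= conjC1 hq.
have sandwich (M : 'M[C]_n) (z : C) : (z%:M - p) *m M *m (z%:M - p) =
    z ^+ 2 *: M - z *: (p *m M + M *m p) + p *m M *m p.
  rewrite mulmxBr !mulmxBl !mul_mx_scalar !mul_scalar_mx -!scalemxAl.
  by move: (M *m p) (p *m M) (p *m M *m p) => u v w;
    apply/matrixP => i j; rewrite !mxE; ring.
have gram (M : 'M[C]_n) (z : C) : Num.conj z = z -> M ^t* = M -> M *m M = M ->
    (M *m (z%:M - p)) ^t* *m (M *m (z%:M - p)) =
    z ^+ 2 *: M - z *: (p *m M + M *m p) + p *m M *m p.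
  move=> zC hM MM; rewrite -(sandwich M z) trmxC_mul (herm1 z zC) hM mulmxA.
  by rewrite -[_ *m M *m M]mulmxA MM.
have qC : (1%:M - q) *m (1%:M - q) = 1%:M - q.
  by rewrite mulmxBr mulmx1 mulmxBl mul1mx qq subrr subr0.
(* Here [A^-1 = x^-1 (1 - q) + y^-1 q], which splits [(A - p) A^-1 (A - p)] into two Gram matrices
   because [(1 - q) A = x (1 - q)] and [q A = y q]. The remainder is [p - p A^-1 p], and [pqp] turns
   [p A^-1 p] into [((1 - k) / x + k / y) p]. *)
have -> : x *: (1%:M - q) + y *: q - p =
    x^-1 *: (((1%:M - q) *m (x%:M - p)) ^t* *m ((1%:M - q) *m (x%:M - p))) +
    y^-1 *: ((q *m (y%:M - p)) ^t* *m (q *m (y%:M - p))) +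
    (1 - ((1 - k) / x + k / y)) *: (p ^t* *m p).
  rewrite !gram // hp pp pqp mulmxBr mulmxBl mulmx1 mulmxBl mul1mx pp pqp.
  move: (p *m q) (q *m p) => u v.
  by apply/matrixP => i j; rewrite !mxE; field; rewrite xN0 yN0.
have tr_gram_ge0 (c : C) (M : 'M[C]_n) : 0 <= c -> 0 <= \tr (S *m (c *: (M ^t* *m M))).
  by move=> c0; rewrite -scalemxAr mxtraceZ mulr_ge0 // psd_tr_ge0.
by rewrite 2!mulmxDr 2!mxtraceD !addr_ge0 //; apply: tr_gram_ge0;
  rewrite ?subr_ge0 ?invr_ge0 // ltW.
Qed.

End TwoProjections.

(** * Maximally entangled projections between the reference and a port *)

Section PortProjections.
Variables (R : realType) (d N : nat).
Local Notation C := R[i].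
Local Notation b := (ports_dim d N).
Local Notation word := {ffun 'I_N -> 'I_d}.

Definition set_port (f : word) (i : 'I_N) (l : 'I_d) : word :=
  [ffun j => if j == i then l else f j].

Definition ref_word (r : 'I_d) (f : word) : 'I_(d * b) :=
  mxtens_index (r, enum_rank f).

Lemma ref_wordP (x : 'I_(d * b)) : exists r f, x = ref_word r f.
Proof.
exists (mxtens_unindex x).1, (enum_val (mxtens_unindex x).2).
by rewrite /ref_word enum_valK -surjective_pairing mxtens_unindexK.
Qed.

Lemma sum_mxtens m n (V : nmodType) (F : 'I_(m * n) -> V) :
  \sum_x F x = \sum_i \sum_j F (mxtens_index (i, j)).
Proof.
rewrite pair_big /= (reindex (@mxtens_index m n)) /=.
  by apply: eq_bigr => -[i j].
by exists (@mxtens_unindex m n) => x _; rewrite (mxtens_indexK, mxtens_unindexK).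
Qed.

Lemma sum_enum_rank (V : nmodType) (F : 'I_b -> V) :
  \sum_x F x = \sum_(f : word) F (enum_rank f).
Proof.
by rewrite (reindex (@enum_rank _)) //=; apply: onW_bij; apply: enum_rank_bij.
Qed.

Lemma sum_ref_word (V : nmodType) (F : 'I_(d * b) -> V) :
  \sum_x F x = \sum_r \sum_f F (ref_word r f).
Proof. by rewrite sum_mxtens; apply: eq_bigr => r _; rewrite sum_enum_rank. Qed.

Lemma set_portE f i l : set_port f i l i = l.
Proof. by rewrite ffunE eqxx. Qed.

Lemma set_port_neq f i l j : j != i -> set_port f i l j = f j.
Proof. by rewrite ffunE => /negPf ->. Qed.

Lemma set_port_id f i : set_port f i (f i) = f.
Proof. by apply/ffunP => j; rewrite ffunE; case: eqP => // ->. Qed.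

Lemma set_port_set f i k l : set_port (set_port f i k) i l = set_port f i l.
Proof. by apply/ffunP => j; rewrite !ffunE; case: eqP. Qed.

Lemma set_portC f i j k l : i != j ->
  set_port (set_port f i k) j l = set_port (set_port f j l) i k.
Proof.
move=> ij; apply/ffunP => h; rewrite !ffunE; case: eqP => // ->.
by rewrite eq_sym (negPf ij).
Qed.

Definition port_word (x : 'I_b) : word := enum_val x.

(* [d] times the projection onto the maximally entangled state of the reference
   system and port [i]. *)
Definition port_overlap (i : 'I_N) : 'M[C]_(d * b) :=
  \matrix_(x, y)
    let: (r, f) := mxtens_unindex x in let: (s, g) := mxtens_unindex y in
    ((port_word f i == r) && (port_word g == set_port (port_word f) i s))%:R.

Local Notation G := port_overlap.

Lemma port_overlapE i r f s g :
  G i (ref_word r f) (ref_word s g) = ((f i == r) && (g == set_port f i s))%:R.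
Proof. by rewrite mxE !mxtens_indexK /port_word !enum_rankK. Qed.

Lemma mul_port_overlap i n (M : 'M[C]_(_, n)) r f y :
  (G i *m M) (ref_word r f) y =
    (f i == r)%:R * \sum_u M (ref_word u (set_port f i u)) y.
Proof.
rewrite mxE sum_ref_word mulr_sumr; apply: eq_bigr => u _.
rewrite (bigD1 (set_port f i u)) //= port_overlapE eqxx andbT big1 ?addr0 //.
by move=> g /negPf ng; rewrite port_overlapE ng andbF mul0r.
Qed.

Lemma port_overlap_sym i : (G i)^T = G i.
Proof.
apply/matrixP => x y; have [r [f ->]] := ref_wordP x; have [s [g ->]] := ref_wordP y.
rewrite mxE !port_overlapE; congr (_%:R); congr nat_of_bool.
by apply/andP/andP => -[/eqP <- /eqP ->];
  rewrite !set_portE !set_port_set set_port_id !eqxx.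
Qed.

Lemma port_overlap_herm i : (G i) ^t* = G i.
Proof.
rewrite port_overlap_sym; apply/matrixP => x y.
have [r [f ->]] := ref_wordP x; have [s [g ->]] := ref_wordP y.
by rewrite mxE port_overlapE conjC_nat.
Qed.

Lemma port_overlap_sq i : G i *m G i = d%:R *: G i.
Proof.
apply/matrixP => x y; have [r [f ->]] := ref_wordP x; have [s [g ->]] := ref_wordP y.
rewrite mul_port_overlap [RHS]mxE port_overlapE.
under eq_bigr do rewrite port_overlapE set_portE eqxx set_port_set /=.
by rewrite sumr_const card_ord -[X in _ * X]mulr_natl mulrCA -mulnb natrM.
Qed.

(** Both inner sums over the reference letter collapse to the single letter [f j], so no factor [d]
    arises, unlike in [port_overlap_sq]. For the projections [G i / d] this is the relation with
    constant [d ^- 2]. *)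
Lemma port_overlap_sandwich i j : i != j -> G i *m G j *m G i = G i.
Proof.
move=> ij; rewrite -mulmxA.
apply/matrixP => x y; have [r [f ->]] := ref_wordP x; have [s [g ->]] := ref_wordP y.
rewrite mul_port_overlap port_overlapE -mulnb natrM; congr (_ * _).
have ji : j != i by rewrite eq_sym.
rewrite (bigD1 (f j)) //= big1 ?addr0; last first.
  move=> u /negPf nu; rewrite mul_port_overlap set_port_neq // eq_sym nu.
  by rewrite mul0r.
rewrite mul_port_overlap set_port_neq // eqxx mul1r.
rewrite (bigD1 (f j)) //= big1 ?addr0; last first.
  move=> u /negPf nu; rewrite port_overlapE set_port_neq // set_portE eq_sym nu.
  by [].
rewrite port_overlapE set_port_neq // set_portE eqxx /=.
by rewrite set_portC // set_port_set -(set_port_neq f s ji) set_port_id.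
Qed.

(** Cutting [M] into blocks along the reference system turns the overlap into entries of blocks
    reduced to port [i], which is the shape in which the channel occurs in its entanglement
    fidelity. *)
Lemma tr_port_overlap (M : 'M[C]_(d * b)) i : \tr (M *m G i) =
  \sum_r \sum_s ptrace_ports i
    (\matrix_(p, q) M (mxtens_index (r, p)) (mxtens_index (s, q))) r s.
Proof.
rewrite -mxtrace_tr trmx_mul port_overlap_sym /mxtrace sum_ref_word.
apply: eq_bigr => r _.
transitivity (\sum_(f : word) \sum_s
    (f i == r)%:R * M (ref_word r f) (ref_word s (set_port f i s))).
  apply: eq_bigr => f _; rewrite mul_port_overlap mulr_sumr.
  by apply: eq_bigr => s _; rewrite mxE.
rewrite exchange_big; apply: eq_bigr => s _ /=; rewrite mxE [RHS]big_mkcond /=.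
apply: eq_bigr => f _; case: ifP => fr; last by rewrite mul0r.
by rewrite mul1r mxE.
Qed.

Lemma tr_ptrace_ports (M : 'M[C]_b) i : \tr (ptrace_ports i M) = \tr M.
Proof.
rewrite /mxtrace [RHS]sum_enum_rank (partition_big (fun f : word => f i) xpredT) //=.
apply: eq_bigr => k _; rewrite mxE; apply: eq_bigr => f /eqP <-.
by rewrite -/(set_port f i (f i)) set_port_id.
Qed.

Lemma ptrace_ports_sum (I : finType) (F : I -> 'M[C]_b) i :
  ptrace_ports i (\sum_k F k) = \sum_k ptrace_ports i (F k).
Proof.
apply/matrixP => k l; rewrite mxE summxE.
under [RHS]eq_bigr do rewrite mxE.
by rewrite exchange_big; apply: eq_bigr => f _; rewrite summxE.
Qed.

Lemma ptrace_portsZ c (M : 'M[C]_b) i :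
  ptrace_ports i (c *: M) = c *: ptrace_ports i M.
Proof.
by apply/matrixP => k l; rewrite !mxE mulr_sumr; apply: eq_bigr => f _; rewrite mxE.
Qed.

End PortProjections.

(** * Closure properties of positive semidefinite matrices, and summation over pairs of ports *)

Section PsdClosure.
Variable R : realType.
Local Notation C := R[i].

Lemma psd_sum n (I : finType) (F : I -> 'M[C]_n) :
  (forall i, psdmx (F i)) -> psdmx (\sum_i F i).
Proof.
move=> hF v; rewrite mulmx_sumr mulmx_suml summxE.
by apply: sumr_ge0 => i _; apply: hF.
Qed.

Lemma psd_congr m n (A : 'M[C]_(m, n)) (S : 'M[C]_n) :
  psdmx S -> psdmx (A *m S *m A ^t*).
Proof. by move=> hS v; have := hS (A ^t* *m v); rewrite trmxC_mul trmxCK !mulmxA. Qed.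

(** The form of [S^T] at [v] is the form of [S] at the entrywise conjugate of [v]. *)
Lemma psd_tr n (S : 'M[C]_n) : psdmx S -> psdmx S^T.
Proof.
move=> hS v; have vv : (map_mx Num.conj v) ^t* = v^T.
  by apply/matrixP => i j; rewrite !mxE conjCK.
have -> : v ^t* *m S^T *m v = ((map_mx Num.conj v) ^t* *m S *m map_mx Num.conj v)^T.
  by rewrite vv !trmx_mul trmxK map_trmx mulmxA.
by rewrite mxE; apply: hS.
Qed.

End PsdClosure.

(** In the sum of the hypotheses over all ordered pairs of distinct indices, each [T i] and each
    [O i i] is counted [N - 1] times, and the off-diagonal [O i j] add up to [u - v]. *)
Lemma sum_offdiag_ge0 (C : numDomainType) N (x y t u v : C)
    (T : 'I_N -> C) (O : 'I_N -> 'I_N -> C) :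
    (forall i j, j != i -> 0 <= x * T i + (y - x) * O i j - O i i) ->
    \sum_i T i = t -> \sum_i \sum_j O i j = u -> \sum_i O i i = v ->
  0 <= (N%:R - 1) * x * t + (y - x) * (u - v) - (N%:R - 1) * v.
Proof.
move=> h <- <- <-; have : 0 <= \sum_i \sum_(j | j != i) (x * T i + (y - x) * O i j - O i i).
  by apply: sumr_ge0 => i _; apply: sumr_ge0 => j; apply: h.
congr (0 <= _).
have -> : \sum_i \sum_(j | j != i) (x * T i + (y - x) * O i j - O i i) =
    \sum_i (N%:R * (x * T i) + (y - x) * (\sum_j O i j) - N%:R * O i i -
      (x * T i + (y - x) * O i i - O i i)).
  apply: eq_bigr => i _; apply/eqP; rewrite eq_sym subr_eq eq_sym; apply/eqP.
  transitivity (\sum_j (x * T i + (y - x) * O i j - O i i)).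
    by rewrite [RHS](bigD1 i) //= addrC.
  rewrite big_split sumrN big_split /= !sumr_const card_ord.
  by rewrite -mulr_sumr !mulr_natl.
rewrite !(big_split, sumrN) /= -!mulr_sumr; ring.
Qed.

(** * States after the measurement and the fidelity inequality *)

Section PostMeasurement.
Variables (R : realType) (d N : nat) (P : pbt_protocol R d N).
Local Notation C := R[i].
Local Notation a := (alice_dim P).
Local Notation b := (ports_dim d N).

(** The summand of [pbt_channel] before its reduction to port [i], so that overlaps with the other
    ports can still be taken. *)
Definition ports_state i (X : 'M[C]_d) : 'M[C]_b :=
  ptrace_l ((povm P i *t (1%:M : 'M[C]_b)) *m
    castmx (mulnA d a b, mulnA d a b) (X *t resource P)).

Lemma pbt_channelE X : pbt_channel P X = \sum_i ptrace_ports i (ports_state i X).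
Proof. by []. Qed.

Lemma cast_mxtens_index (m n p : nat) (e : (m * n * p)%N = (m * (n * p))%N) x y :
  cast_ord e (mxtens_index (x, y)) =
  mxtens_index ((mxtens_unindex x).1, mxtens_index ((mxtens_unindex x).2, y)).
Proof.
have [[i j] ->] : exists ij, x = mxtens_index ij.
  by exists (mxtens_unindex x); rewrite mxtens_unindexK.
by rewrite mxtens_indexK; apply: val_inj => /=; rewrite mulnDl mulnA addnA.
Qed.

Lemma ports_stateE i X p q : ports_state i X p q =
  \sum_x \sum_y povm P i x y *
    (X (mxtens_unindex y).1 (mxtens_unindex x).1 *
     resource P (mxtens_index ((mxtens_unindex y).2, p))
                (mxtens_index ((mxtens_unindex x).2, q))).
Proof.
rewrite mxE; apply: eq_bigr => x _; rewrite mxE sum_mxtens.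
apply: eq_bigr => y _; rewrite (bigD1 p) //= big1 ?addr0 => [|p' /negPf np].
  by rewrite tensmxE mxE eqxx mulr1 castmxE !cast_mxtens_index tensmxE.
by rewrite tensmxE [_ p p']mxE eq_sym np mulr0 mul0r.
Qed.

(** No signalling: the POVM elements add up to the identity, so forgetting the outcome leaves the
    marginal of the resource on the ports. *)
Lemma sum_ports_state X : \sum_i ports_state i X = \tr X *: ptrace_l (resource P).
Proof.
apply/matrixP => p q; rewrite summxE [RHS]mxE [in RHS]mxE.
under eq_bigr do rewrite ports_stateE.
rewrite exchange_big /=.
transitivity (\sum_(x : 'I_(d * a)) (X (mxtens_unindex x).1 (mxtens_unindex x).1 *
     resource P (mxtens_index ((mxtens_unindex x).2, p))
                (mxtens_index ((mxtens_unindex x).2, q)))).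
  apply: eq_bigr => x _; rewrite exchange_big /= (bigD1 x) //= [X in _ + X]big1 ?addr0.
    by rewrite -mulr_suml -summxE povm_sum mxE eqxx mul1r.
  by move=> y /negPf nx; rewrite -mulr_suml -summxE povm_sum mxE eq_sym nx mul0r.
rewrite sum_mxtens mulr_suml; apply: eq_bigr => k _; rewrite mulr_sumr.
by apply: eq_bigr => u _; rewrite mxtens_indexK.
Qed.

(* [d] times the state of the reference system and the ports after outcome [i],
   not normalised, when half of a maximally entangled state is teleported. *)
Definition post_state i : 'M[C]_(d * b) :=
  \matrix_(x, y) ports_state i
    (delta_mx (mxtens_unindex x).1 (mxtens_unindex y).1)
    (mxtens_unindex x).2 (mxtens_unindex y).2.

(** Write the resource as [B ^t* *m B]. Each row [t] of [B] yields an operator [A t] from input and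
    Alice to reference and ports, and [post_state i] is a sum of congruences by the [A t]. The POVM
    element enters transposed because the reference carries the transposed indices of the input. *)
Lemma post_state_psd i : psdmx (post_state i).
Proof.
have [B rhoE] := psd_factor (resource_density P).1.
pose A t : 'M[C]_(d * b, d * a) := \matrix_(x, y)
  (((mxtens_unindex y).1 == (mxtens_unindex x).1)%:R *
   Num.conj (B t (mxtens_index ((mxtens_unindex y).2, (mxtens_unindex x).2)))).
have -> : post_state i = \sum_t A t *m (povm P i)^T *m (A t) ^t*.
  apply/matrixP => x y; rewrite summxE mxE ports_stateE.
  under [RHS]eq_bigr do rewrite mxE.
  rewrite [RHS]exchange_big; apply: eq_bigr => x' _ /=.
  under [RHS]eq_bigr do rewrite mxE mulr_suml.
  rewrite [RHS]exchange_big; apply: eq_bigr => y' _ /=.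
  rewrite rhoE !mxE !mulr_sumr; apply: eq_bigr => t _; rewrite !mxE.
  rewrite rmorphM /= conjCK conjC_nat -mulnb natrM.
  by rewrite -!mulrA [LHS]mulrC; ring.
by apply: psd_sum => t; apply/psd_congr/psd_tr/povm_psd.
Qed.

Lemma tr_post_state i : \tr (post_state i) = \sum_r \tr (ports_state i (delta_mx r r)).
Proof.
rewrite /mxtrace sum_mxtens; apply: eq_bigr => r _; apply: eq_bigr => p _.
by rewrite mxE mxtens_indexK.
Qed.

Lemma tr_post_state_overlap i j : \tr (post_state i *m port_overlap R d j) =
  \sum_r \sum_s ptrace_ports j (ports_state i (delta_mx r s)) r s.
Proof.
rewrite tr_port_overlap; apply: eq_bigr => r _; apply: eq_bigr => s _.
congr (ptrace_ports _ _ _ _); apply/matrixP => p q.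
by rewrite !mxE !mxtens_indexK.
Qed.

Lemma tr_ptrace_l m n (M : 'M[C]_(m * n)) : \tr (ptrace_l M) = \tr M.
Proof.
rewrite /mxtrace sum_mxtens exchange_big; apply: eq_bigr => k _.
by rewrite mxE.
Qed.

Lemma mxtrace_delta r s : \tr (delta_mx r s : 'M[C]_d) = (r == s)%:R.
Proof.
rewrite /mxtrace (bigD1 r) //= mxE eqxx /= big1 ?addr0 // => k /negPf nk.
by rewrite mxE nk.
Qed.

Lemma sum_tr_post_state : \sum_i \tr (post_state i) = d%:R.
Proof.
under eq_bigr do rewrite tr_post_state.
rewrite exchange_big /= -[d in RHS]card_ord -sum1_card natr_sum.
apply: eq_bigr => r _; rewrite -linear_sum /= sum_ports_state mxtraceZ tr_ptrace_l.
by rewrite (resource_density P).2 mulr1 mxtrace_delta eqxx.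
Qed.

(** By no signalling the summed state is the identity of the reference tensored with the marginal on
    the ports. Only the blocks [r = s] survive, and they give the trace of the marginal. *)
Lemma sum_tr_post_state_overlap j :
  \sum_i \tr (post_state i *m port_overlap R d j) = 1.
Proof.
under eq_bigr do rewrite tr_post_state_overlap.
rewrite exchange_big /= -(resource_density P).2 -tr_ptrace_l -(tr_ptrace_ports _ j).
apply: eq_bigr => r _; rewrite exchange_big /=.
have sumE s : \sum_i ptrace_ports j (ports_state i (delta_mx r s)) r s =
    (r == s)%:R * ptrace_ports j (ptrace_l (resource P)) r s.
  rewrite -summxE -ptrace_ports_sum sum_ports_state ptrace_portsZ mxE.
  by rewrite mxtrace_delta.
under eq_bigr do rewrite sumE.
rewrite (bigD1 r) //= eqxx mul1r big1 ?addr0 // => s /negPf ns.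
by rewrite eq_sym ns mul0r.
Qed.

(** For linear [f], the expectation of the maximally entangled projection in the image of the
    maximally entangled state under [f] tensored with the identity. The formula is linear in [f], so
    it also serves for differences of channels. *)
Definition entanglement_fidelity (f : 'M[C]_d -> 'M[C]_d) : C :=
  d%:R ^- 2 * \sum_r \sum_s f (delta_mx r s) r s.

Local Notation F := (entanglement_fidelity (pbt_channel P)).

Lemma sum_tr_post_state_overlap_diag : (0 < d)%N ->
  \sum_i \tr (post_state i *m port_overlap R d i) = d%:R ^+ 2 * F.
Proof.
move=> d0; rewrite mulrA divff ?mul1r ?expf_neq0 ?pnatr_eq0 -?lt0n //.
under eq_bigr do rewrite tr_post_state_overlap.
rewrite exchange_big; apply: eq_bigr => r _ /=.
rewrite exchange_big; apply: eq_bigr => s _ /=.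
by rewrite pbt_channelE summxE.
Qed.

Lemma tr_pbt_channel X : \tr (pbt_channel P X) = \tr X.
Proof.
rewrite pbt_channelE linear_sum /=.
under eq_bigr do rewrite tr_ptrace_ports.
rewrite -linear_sum /= sum_ports_state mxtraceZ tr_ptrace_l.
by rewrite (resource_density P).2 mulr1.
Qed.

(** The two-projection inequality with [k = d ^- 2] is summed over all ordered pairs of distinct
    ports. The totals are [d] for the traces, [d F] for the diagonal overlaps and [N / d] for all
    overlaps; a common factor [d] is then divided out. *)
Lemma pbt_fidelity_ineq (x y : C) : (0 < d)%N -> 0 < x -> 0 < y ->
    (1 - d%:R ^- 2) / x + d%:R ^- 2 / y <= 1 ->
  0 <= (N%:R - 1) * x + (y - x) * (N%:R / d%:R ^+ 2 - F) - (N%:R - 1) * F.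
Proof.
move=> d0 x0 y0 hxy; have dN0 : d%:R != 0 :> C by rewrite pnatr_eq0 -lt0n.
pose phi (i : 'I_N) : 'M[C]_(d * b) := d%:R^-1 *: port_overlap R d i.
have phiC i : (phi i) ^t* = phi i.
  by rewrite /phi linearZ /= map_mxZ port_overlap_herm /= fmorphV /= conjC_nat.
have phiM i : phi i *m phi i = phi i.
  by rewrite -scalemxAl -scalemxAr port_overlap_sq !scalerA mulfVK.
have term i j : j != i -> 0 <= x * \tr (post_state i) +
    (y - x) * \tr (post_state i *m phi j) - \tr (post_state i *m phi i).
  move=> ji; have ij : i != j by rewrite eq_sym.
  have sand : phi i *m phi j *m phi i = d%:R ^- 2 *: phi i.
    have sc n (c : C) (A B : 'M[C]_n) :
        (c *: A) *m (c *: B) *m (c *: A) = c ^+ 2 *: (c *: (A *m B *m A)).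
      rewrite -!scalemxAl -!scalemxAr -!scalemxAl !scalerA.
      by congr (_ *: _); rewrite expr2 mulrA.
    by rewrite /phi sc port_overlap_sandwich // exprVn.
  exact: (two_projections_ge0 (post_state_psd i) (phiC i) (phiC j) (phiM i)
    (phiM j) sand x0 y0 hxy).
have trphi i j : \tr (post_state i *m phi j) =
    d%:R^-1 * \tr (post_state i *m port_overlap R d j).
  by rewrite -scalemxAr mxtraceZ.
have diag : \sum_i \tr (post_state i *m phi i) = d%:R * F.
  under eq_bigr do rewrite trphi.
  by rewrite -mulr_sumr sum_tr_post_state_overlap_diag // expr2 -mulrA mulKf.
have total : \sum_i \sum_j \tr (post_state i *m phi j) = N%:R / d%:R.
  rewrite exchange_big /= -[in RHS](card_ord N) -sum1_card natr_sum mulr_suml.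
  apply: eq_bigr => j _; under eq_bigr do rewrite trphi.
  by rewrite -mulr_sumr sum_tr_post_state_overlap mulr1 mul1r.
have := sum_offdiag_ge0 term sum_tr_post_state total diag.
rewrite -(pmulr_rge0 _ (_ : 0 < d%:R^-1)) ?invr_gt0 ?ltr0n //.
by congr (0 <= _); field.
Qed.

End PostMeasurement.

(** * From the diamond norm to the entanglement fidelity *)

Section DiamondFidelity.
Variables (R : realType) (d : nat).
Local Notation C := R[i].

Lemma ampliationE m n e (f : {linear 'M[C]_m -> 'M[C]_n}) (M : 'M[C]_(m * e))
    x y k l :
  ampliation f M (mxtens_index (x, k)) (mxtens_index (y, l)) =
  f (\matrix_(x', y') M (mxtens_index (x', k)) (mxtens_index (y', l))) x y.
Proof.
rewrite summxE (bigD1 k) //= [X in _ + X]big1 ?addr0 => [|k' /negPf nk].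
  rewrite summxE (bigD1 l) //= big1 ?addr0 => [|l' /negPf nl].
    by rewrite tensmxE mxE !eqxx mulr1.
  by rewrite tensmxE mxE [l == _]eq_sym nl andbF mulr0.
rewrite summxE big1 // => l' _.
by rewrite tensmxE mxE [k == _]eq_sym nk mulr0.
Qed.

Definition maxent_vec : 'cV[C]_(d * d) :=
  \col_x ((mxtens_unindex x).1 == (mxtens_unindex x).2)%:R.

Definition maxent : 'M[C]_(d * d) := d%:R^-1 *: (maxent_vec *m maxent_vec ^t*).

Lemma sum_maxent_vec (V : lmodType C) (F : 'I_(d * d) -> V) :
  \sum_x maxent_vec x 0 *: F x = \sum_r F (mxtens_index (r, r)).
Proof.
rewrite sum_mxtens; apply: eq_bigr => r _; rewrite (bigD1 r) //= big1 ?addr0.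
  by rewrite mxE mxtens_indexK eqxx scale1r.
by move=> s /negPf ns; rewrite mxE mxtens_indexK eq_sym ns scale0r.
Qed.

Lemma maxent_vec_real x : Num.conj (maxent_vec x 0) = maxent_vec x 0.
Proof. by rewrite mxE conjC_nat. Qed.

Lemma maxent_form (M : 'M[C]_(d * d)) : (maxent_vec ^t* *m M *m maxent_vec) 0 0 =
  \sum_r \sum_s M (mxtens_index (r, r)) (mxtens_index (s, s)).
Proof.
rewrite -mulmxA mxE; transitivity (\sum_x maxent_vec x 0 *: (M *m maxent_vec) x 0).
  by apply: eq_bigr => x _; rewrite 2!mxE maxent_vec_real.
rewrite (sum_maxent_vec (V := C^o)); apply: eq_bigr => r _.
rewrite mxE -(sum_maxent_vec (V := C^o)); apply: eq_bigr => x _.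
by rewrite mulrC.
Qed.

Lemma maxentE x y k l :
  maxent (mxtens_index (x, k)) (mxtens_index (y, l)) =
  d%:R^-1 * ((x == k) && (y == l))%:R.
Proof.
rewrite !mxE big_ord1 !mxE !mxtens_indexK conjC_nat.
by rewrite -mulnb natrM.
Qed.

Hypothesis d_gt0 : (0 < d)%N.

Let dN0 : d%:R != 0 :> C.
Proof. by rewrite pnatr_eq0 -lt0n. Qed.

Lemma maxent_vec_norm : maxent_vec ^t* *m maxent_vec = d%:R%:M.
Proof.
apply/matrixP => i j; rewrite !ord1 -{1}[maxent_vec ^t*]mulmx1 maxent_form.
under eq_bigr => r _.
  rewrite (bigD1 r) //= mxE eqxx big1 ?addr0; last first.
    move=> s /negPf ns; rewrite mxE (inj_eq (can_inj (@mxtens_indexK d d))).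
    by rewrite xpair_eqE eq_sym ns.
  over.
by rewrite sumr_const card_ord !mxE eqxx.
Qed.

Lemma maxent_density : density maxent.
Proof.
split.
  move=> v; rewrite -scalemxAr -scalemxAl mxE mulr_ge0 ?invr_ge0 ?ler0n //.
  by have := psd_gram (maxent_vec ^t*) v; rewrite trmxCK.
by rewrite mxtraceZ mxtrace_mulC maxent_vec_norm mxtrace_scalar mulr1n mulVf.
Qed.

(** This reflection is the test unitary for the trace norm: on a traceless [X] it gives
    [- 2 \tr (maxent *m X)]. *)
Lemma maxent_reflection_unitary : 1%:M - 2 *: maxent \is unitarymx.
Proof.
have sq : maxent *m maxent = maxent.
  rewrite /maxent -scalemxAl -scalemxAr mulmxA -[_ *m _ *m maxent_vec]mulmxA.
  rewrite maxent_vec_norm mul_mx_scalar -scalemxAl !scalerA.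
  by rewrite mulVf ?mulr1.
have herm : (1%:M - 2 *: maxent) ^t* = 1%:M - 2 *: maxent.
  rewrite -{2}(psd_hermitian maxent_density.1); move: maxent => M.
  by apply/matrixP => i j; rewrite !mxE rmorphB rmorphM /= !conjC_nat eq_sym.
apply: (introT unitarymxP); rewrite herm.
rewrite mulmxBr mulmx1 mulmxBl mul1mx -scalemxAl -scalemxAr sq.
by move: maxent => M; apply/matrixP => i j; rewrite !mxE; ring.
Qed.

Lemma tr_maxent_mul (M : 'M[C]_(d * d)) : \tr (maxent *m M) =
  d%:R^-1 * \sum_r \sum_s M (mxtens_index (r, r)) (mxtens_index (s, s)).
Proof.
by rewrite -maxent_form -scalemxAl mxtraceZ -mulmxA mxtrace_mulC trace_mx11.
Qed.

(** The maximally entangled state is one candidate in the supremum, and its image is traceless. For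
    a channel minus the identity the left side is [2 (1 - F)]. *)
Lemma fidelity_le_diamond (f : {linear 'M[C]_d -> 'M[C]_d}) (eps : R) :
    (forall X, \tr (f X) = 0) -> (diamond_norm f <= eps%:E)%E ->
  - 2 * complex.Re (entanglement_fidelity f) <= eps.
Proof.
move=> trf hf; pose X := ampliation f maxent.
(* [X] is the normalised Choi matrix of [f]. *)
have XE x y k l : X (mxtens_index (x, k)) (mxtens_index (y, l)) =
    d%:R^-1 * f (delta_mx k l) x y.
  rewrite ampliationE; transitivity (f (d%:R^-1 *: delta_mx k l) x y).
    congr (f _ x y); apply/matrixP => i j.
    by rewrite mxE maxentE !mxE.
  by rewrite linearZ mxE.
have trX : \tr X = 0.
  rewrite /mxtrace sum_mxtens exchange_big big1 // => k _ /=.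
  under eq_bigr do rewrite XE.
  by rewrite -mulr_sumr -/(\tr _) trf mulr0.
have trPX : \tr (maxent *m X) = entanglement_fidelity f.
  rewrite tr_maxent_mul /entanglement_fidelity -exprVn expr2 -mulrA; congr (_ * _).
  rewrite mulr_sumr; apply: eq_bigr => r _; rewrite mulr_sumr.
  by apply: eq_bigr => s _; rewrite XE.
have := Re_tr_le_trace_norm X maxent_reflection_unitary.
rewrite mulmxBl mul1mx -scalemxAl !linearB /= linearZ /= trX trPX sub0r.
have -> z : complex.Re (2 * z) = 2 * complex.Re z :> R.
  by rewrite !mulr_natl raddfMn.
rewrite mulNr => /le_trans; apply; rewrite -lee_fin; apply: (le_trans _ hf).
by apply: ereal_sup_ubound; exists d, maxent; split => //; apply: maxent_density.
Qed.

End DiamondFidelity.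

(** * The numerical estimate and the conclusion *)

(** With [c = s D] the infidelity bound [s ^+ 2 / 4] is [c ^+ 2 / (4 D ^+ 2)], so clearing
    denominators cancels one factor [c] and the [D ^+ 2] on the right ([key3]). If the claim failed,
    then [c n <= D ^+ 2 / 2]; with [c ^+ 2 <= 3 / 2 D ^+ 2] and [D ^+ 2 >= 4] the left side of
    [key3] would exceed the right one. *)
Lemma port_number_bound (R : realFieldType) (D n s f : R) (c := s * D)
    (x := 1 - c / (D ^+ 2 * (1 + c))) :
    2 <= D -> 1 <= n -> 0 < s -> s ^+ 2 <= 3 / 2 -> 1 - f <= s ^+ 2 / 4 ->
    0 <= (n - 1) * x + c * (n / D ^+ 2 - f) - (n - 1) * f ->
  D <= n * (2 * s).
Proof.
move=> hD hn hs hs2 hf hx; rewrite leNgt; apply/negP => hlt.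
have c0 : 0 < c by rewrite mulr_gt0 //; lra.
have D0 : 0 < D by lra.
have [DN0 cN0] : D != 0 /\ 1 + c != 0 by split; apply: lt0r_neq0; lra.
have key : c * ((D ^+ 2 - 1) * (1 + c) - (n - 1) * c)
    <= (1 - f) * ((n - 1 + c) * (D ^+ 2 * (1 + c))).
  rewrite -subr_ge0; have p : 0 <= D ^+ 2 * (1 + c) by rewrite mulr_ge0 ?sqr_ge0 //; lra.
  have := mulr_ge0 hx p; congr (0 <= _).
  by rewrite /x; field; rewrite DN0 cN0.
have key2 : c * ((D ^+ 2 - 1) * (1 + c) - (n - 1) * c)
    <= s ^+ 2 / 4 * ((n - 1 + c) * (D ^+ 2 * (1 + c))).
  apply: (le_trans key); rewrite ler_wpM2r // mulr_ge0 ?mulr_ge0 ?sqr_ge0 //; lra.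
have key3 : (D ^+ 2 - 1) * (1 + c) - (n - 1) * c <= c / 4 * (n - 1 + c) * (1 + c).
  rewrite -(ler_pM2l c0); apply: (le_trans key2).
  by rewrite le_eqVlt; apply/orP; left; apply/eqP; rewrite /c; field.
have cn : 2 * (c * n) <= D ^+ 2.
  have := ltW hlt; rewrite -(ler_pM2l D0) => h.
  by rewrite [X in X <= _](_ : _ = D * (n * (2 * s))) ?expr2 // /c; ring.
have cc : c ^+ 2 <= 3 / 2 * D ^+ 2 by rewrite /c exprMn ler_wpM2r ?sqr_ge0.
have D4 : 4 <= D ^+ 2 by nra.
have h1 : c * n * (1 + c) <= D ^+ 2 / 2 * (1 + c) by rewrite ler_wpM2r //; lra.
have h2 : c * c ^+ 2 <= c * (3 / 2 * D ^+ 2) by rewrite ler_wpM2l // ltW.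
have h3 : 0 <= c * (D ^+ 2 - 4) by rewrite mulr_ge0 //; lra.
nra.
Qed.

(** Without outcomes the traces of the post-measurement states would add up to 0 instead of [d]. *)
Lemma port_number_gt0 (R : realType) (d N : nat) (P : pbt_protocol R d N) :
  (0 < d)%N -> (0 < N)%N.
Proof.
move=> d0; rewrite lt0n; apply/eqP => N0; have := sum_tr_post_state P.
rewrite big1 => [/eqP|i _]; first by rewrite eq_sym pnatr_eq0 -leqn0 leqNgt d0.
by case: i => i hi; exfalso; move: hi; rewrite N0.
Qed.

Theorem theorem4p58 (R : realType) (d N : nat) (eps : R)
    (hd : (2 <= d)%N) (heps0 : 0 < eps) (heps1 : eps <= 1 / Num.sqrt 2)
    (P : pbt_protocol R d N) (hP : is_pbt P eps) :
  d%:R / (2 * Num.sqrt (2 * eps)) <= N%:R :> R.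
Proof.
have d0 : (0 < d)%N by apply: ltn_trans hd.
set s := Num.sqrt (2 * eps).
have s0 : 0 < s by rewrite sqrtr_gt0; lra.
have s2 : s ^+ 2 = 2 * eps by rewrite sqr_sqrtr //; lra.
have s_le : s ^+ 2 <= 3 / 2.
  have q0 : 0 < Num.sqrt 2 :> R by rewrite sqrtr_gt0.
  have q2 : Num.sqrt 2 ^+ 2 = 2 :> R by rewrite sqr_sqrtr.
  move: heps1; rewrite ler_pdivlMr // s2 => h.
  (* A rational bound on the root suffices: it gives [eps <= 3 / 4]. *)
  have : 4 / 3 <= Num.sqrt 2 :> R by nra.
  nra.
rewrite ler_pdivrMr ?mulr_gt0 //.
set F := entanglement_fidelity (pbt_channel P).
(* The identity has fidelity 1, as each of the [d ^+ 2] matrix units contributes 1. *)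
have fid : entanglement_fidelity (pbt_channel P \- idfun) = F - 1.
  rewrite /F /entanglement_fidelity -[X in _ - X](@mulVf _ (d%:R ^+ 2)); last first.
    by rewrite expf_neq0 // pnatr_eq0 -lt0n.
  rewrite -mulrBr; congr (_ * _).
  have -> : d%:R ^+ 2 = \sum_(r < d) \sum_(k < d) 1 :> R[i].
    by rewrite !sumr_const !card_ord -[RHS]mulr_natr expr2.
  rewrite -sumrB; apply: eq_bigr => r _; rewrite -sumrB.
  by apply: eq_bigr => k _; rewrite !mxE !eqxx.
have tr0 X : \tr ((pbt_channel P \- idfun) X) = 0.
  by rewrite /= linearB /= tr_pbt_channel subrr.
have := fidelity_le_diamond d0 tr0 hP; rewrite fid.
have -> : complex.Re (F - 1) = complex.Re F - 1 by case: (F).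
move=> hF; set D := d%:R : R; set n := N%:R : R.
have D2 : 2 <= D by rewrite /D (ler_nat _ 2).
have n1 : 1 <= n by rewrite /n (ler_nat _ 1) (port_number_gt0 P).
(* The fidelity inequality is used with [y = x + c]. Equality in its side condition is a quadratic
   equation in [x]; the chosen [x] is one Newton step from 1 towards its root, which leaves the
   slack [(1 - x) ^+ 2 / (x (x + c))]. *)
pose c := s * D; pose x := 1 - c / (D ^+ 2 * (1 + c)).
have c0 : 0 < c by rewrite mulr_gt0 //; lra.
apply: (@port_number_bound _ D n s (complex.Re F)) => //; first by rewrite s2; lra.
rewrite -/c -/x.
have D0 : 0 < D by lra.
have D1 : 1 <= D ^+ 2 by nra.
have [DN0 cN0] : D != 0 /\ 1 + c != 0 by split; apply: lt0r_neq0; lra.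
have x0 : 0 < x.
  by rewrite subr_gt0 ltr_pdivrMr ?mul1r ?mulr_gt0 ?exprn_gt0 //; nra.
have cond : (1 - D ^- 2) / x + D ^- 2 / (x + c) <= 1.
  rewrite -subr_ge0 (_ : _ - _ = (1 - x) ^+ 2 / (x * (x + c))).
    by rewrite divr_ge0 ?sqr_ge0 // ltW // mulr_gt0 // addr_gt0.
  have kE : D ^- 2 = (1 - x) * (1 + c) / c.
    by rewrite /x; field; rewrite DN0 cN0 lt0r_neq0.
  by rewrite kE; field; rewrite !lt0r_neq0 // addr_gt0.
have toC := (rmorphD, rmorphN, rmorphM, fmorphV, rmorphXn, rmorph_nat, rmorph1).
have condC : (1 - d%:R ^- 2) / x%:C%C + d%:R ^- 2 / (x + c)%:C%C <= 1.
  have -> : (1 - d%:R ^- 2) / x%:C%C + d%:R ^- 2 / (x + c)%:C%C =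
      ((1 - D ^- 2) / x + D ^- 2 / (x + c))%:C%C.
    by rewrite !toC.
  by rewrite (lecR _ 1).
have x0C : 0 < x%:C%C by rewrite (ltcR 0).
have y0C : 0 < (x + c)%:C%C by rewrite (ltcR 0) addr_gt0.
have := pbt_fidelity_ineq P d0 x0C y0C condC; rewrite -/F.
have -> : (N%:R - 1) * x%:C%C + ((x + c)%:C%C - x%:C%C) * (N%:R / d%:R ^+ 2 - F) -
    (N%:R - 1) * F = ((n - 1) * x + c * (n / D ^+ 2))%:C%C - (n - 1 + c)%:C%C * F.
  by rewrite !toC; ring.
(* Only the comparison of real parts is kept, which puts [complex.Re F] in the role of [f]. *)
rewrite lecE => /andP[_]; congr (_ <= _).
by case: (F) => p q /=; ring.
Qed.
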